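(* Let $S(A,b)\neq\emptyset$. For each $i\in I$ let $\mathbf u^{i*}=(u^{i*},\dots,u^{i*})$ be the unique optimal solution of the problem of minimizing $y$ subject to $\sum_{j\in J}T_L(a_{ij},y)\ge b_i$, $y\in[0,1]$, and let $\mathbf u^*=(u^*,\dots,u^* )$ with $u^*=\bigvee_{i\in I}u^{i*}$. Then $\mathbf u^*$ is the unique optimal solution of the problem $$\text{minimize } Z(\mathbf y)=y\quad\text{subject to}\quad \sum_{j\in J}T_L(a_{ij},y)\ge b_i\ \text{ for all } i\in I,$$ where $\mathbf y=(y,\dots,y)$, $y\in[0,1]$. Further, $\mathbf u^*$ is the greatest optimal solution of the problem of minimizing $Z(x)=x_1\vee x_2\vee\cdots\vee x_n$ over $x\in S(A,b)$.
   Context: Let $I=\{1,\dots,m\}$, $J=\{1,\dots,n\}$, $A=(a_{ij})_{m\times n}$ with $a_{ij}\in[0,1]$, and $b=(b_1,\dots,b_m)$ with $b_i>0$ real. The Łukasiewicz t-norm is $T_L(a,x)=\max\{a+x-1,0\}$ on $[0,1]^2$. The solution set is $S(A,b)=\{x\in[0,1]^n : \sum_{j\in J}T_L(a_{ij},x_j)\ge b_i \text{ for all } i\in I\}$. The symbol $\vee$ denotes maximum; vectors are ordered componentwise. The greatest optimal solution is an optimal solution that is $\ge$ every optimal solution in the componentwise order. If $S(A,b)\ne\emptyset$, each single-constraint problem (for fixed $i$) has a unique optimal solution, so $\mathbf u^{i*}$ is well defined. *)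

(* Defs.v *)
From HB Require Import structures.
From mathcomp Require Import all_boot all_order all_algebra.
From mathcomp Require Import all_classical all_reals.

Set Implicit Arguments.
Unset Strict Implicit.
Unset Printing Implicit Defensive.

Import Order.TTheory GRing.Theory Num.Theory.
Local Open Scope classical_set_scope.
Local Open Scope ring_scope.

Section Optimization.
Variables (R : realType) (T : Type).
Implicit Types (F : set T) (Z : T -> R) (x : T).

Definition optimal_solution F Z x : Prop :=
  F x /\ forall x', F x' -> Z x <= Z x'.

Definition unique_optimal_solution F Z x : Prop :=
  optimal_solution F Z x /\ forall x', optimal_solution F Z x' -> x' = x.

End Optimization.

Section FuzzyRelationInequalities.
Variable R : realType.

Definition lukasiewicz (a x : R) : R := Num.max (a + x - 1) 0.

(* All maxima taken below are over families in [0, 1], hence the seed 0. *)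
Definition vmax (k : nat) (f : 'I_k -> R) : R := \big[Num.max/0]_(i < k) f i.

Definition greatest_optimal_solution (n : nat) (F : set 'rV[R]_n)
    (Z : 'rV[R]_n -> R) (x : 'rV[R]_n) : Prop :=
  optimal_solution F Z x /\
  forall x', optimal_solution F Z x' -> forall j, x' 0 j <= x 0 j.

Variables (m n : nat) (A : 'M[R]_(m, n)) (b : 'rV[R]_m).

Definition solution_set : set 'rV[R]_n :=
  [set x | (forall j, 0 <= x 0 j <= 1) /\
           forall i, b 0 i <= \sum_(j < n) lukasiewicz (A i j) (x 0 j)].

(* The constant vector (y, ..., y) is represented by the scalar y. *)
Definition single_feasible (i : 'I_m) : set R :=
  [set y | 0 <= y <= 1 /\ b 0 i <= \sum_(j < n) lukasiewicz (A i j) y].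

Definition constant_feasible : set R :=
  [set y | 0 <= y <= 1 /\
           forall i, b 0 i <= \sum_(j < n) lukasiewicz (A i j) y].

(* Definite description: the value 0 is only a default, taken when there is  *)
(* no unique optimal solution.                                               *)
Definition u_single (i : 'I_m) : R :=
  xget 0 [set y | unique_optimal_solution (single_feasible i) id y].

Definition u_star : R := vmax u_single.

Definition max_component (x : 'rV[R]_n) : R := vmax (fun j => x 0 j).

End FuzzyRelationInequalities.

(* Main.v *)
(* Each left-hand side is nondecreasing and n-Lipschitz in y, so the feasible *)
(* set of a single constraint is an up-set of [0, 1] that contains its        *)
(* infimum.  By monotonicity y satisfies all the constraints iff it dominates *)
(* every u^{i*}, i.e. iff u* <= y.  For x in S(A,b), replacing every          *)
(* component of x by their maximum keeps feasibility, so u* <= max_j x_j;     *)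
(* an optimal x has all its components below that maximum, which is then u*.  *)
Require Import Defs.
From HB Require Import structures.
From mathcomp Require Import all_boot all_order all_algebra.
From mathcomp Require Import all_classical all_reals.
From mathcomp Require Import lra.

Set Implicit Arguments.
Unset Strict Implicit.
Unset Printing Implicit Defensive.

Import Order.TTheory GRing.Theory Num.Theory.
Local Open Scope classical_set_scope.
Local Open Scope ring_scope.

(** Both halves rest on [u_star_optimal]. Attainment for one constraint comes from
    [single_feasible_inf], and [single_feasible_le] carries each constraint up from [u_single] to
    [u_star]. [max_component_feasible] then transfers the bound [u_star A b <= y] from constant
    vectors to all of [solution_set]. *)

Lemma unique_optimal_solution_id (R : realType) (F : set R) (y : R) :
  optimal_solution F id y -> unique_optimal_solution F id y.
Proof.
move=> [Fy miny]; split=> // y' [Fy' miny'].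
by apply/eqP; rewrite eq_le miny' //= miny.
Qed.

Section Lukasiewicz.
Variable R : realType.
Implicit Types a x y : R.

Lemma le_lukasiewicz a x y : x <= y -> lukasiewicz a x <= lukasiewicz a y.
Proof.
move=> xy; rewrite /lukasiewicz.
by case: (leP (a + x - 1)); case: (leP (a + y - 1)); lra.
Qed.

(** This quantitative continuity replaces a topological argument that the feasible set is closed. *)
Lemma lukasiewicz_lipschitz a x y :
  x <= y -> lukasiewicz a y <= lukasiewicz a x + (y - x).
Proof.
move=> xy; rewrite /lukasiewicz.
by case: (leP (a + x - 1)); case: (leP (a + y - 1)); lra.
Qed.

End Lukasiewicz.

Section Vmax.
Variables (R : realType) (k : nat) (f : 'I_k -> R).

Lemma le_vmax i : f i <= vmax f.
Proof. exact: (le_bigmax _ f). Qed.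

Lemma vmax_ge0 : 0 <= vmax f.
Proof. exact: bigmax_ge_id. Qed.

Lemma vmax_le y : 0 <= y -> (forall i, f i <= y) -> vmax f <= y.
Proof. by move=> y0 fy; apply: bigmax_le. Qed.

End Vmax.

Section FuzzyRelationInequalities.
Variables (R : realType) (m n : nat) (A : 'M[R]_(m, n)) (b : 'rV[R]_m).

Lemma single_feasible_le i x y : x <= y -> y <= 1 ->
  single_feasible A b i x -> single_feasible A b i y.
Proof.
move=> xy y1 [/andP[x0 _] bx]; split; first by rewrite y1 (le_trans x0).
by apply: le_trans bx _; apply: ler_sum => j _; apply: le_lukasiewicz.
Qed.

(** If the infimum missed the constraint by a gap, a feasible point close enough to it would, by the
    Lipschitz bound, still miss it. *)
Lemma single_feasible_inf i :
  single_feasible A b i !=set0 ->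
  optimal_solution (single_feasible A b i) id (inf (single_feasible A b i)).
Proof.
set F := single_feasible A b i => F0.
have Flb : lbound F 0 by move=> y [/andP[]].
have hinf : has_inf F by split=> //; exists 0.
have minF y : F y -> inf F <= y by apply: ge_inf; exists 0.
split=> //; split.
  apply/andP; split; first exact: lb_le_inf.
  by case: F0 => y Fy; apply: le_trans (minF y Fy) _; case: Fy => /andP[].
rewrite leNgt; apply/negP => lt_b.
set s := \sum_(j < n) _ in lt_b.
(* The gap is divided by [n.+1] rather than [n] so that the divisor is positive even when [n = 0];
   the surplus term [y - inf F] is nonnegative. *)
have n1 : 0 < n.+1%:R :> R by rewrite ltr0n.
have e0 : 0 < (b 0 i - s) / n.+1%:R by rewrite divr_gt0 // subr_gt0.
have [y Fy ylt] := inf_adherent e0 hinf.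
have {ylt} : (y - inf F) * n.+1%:R < b 0 i - s.
  by rewrite -ltr_pdivlMr // ltrBlDl.
have : b 0 i <= s + (y - inf F) * n%:R.
  case: (Fy) => _ /le_trans; apply.
  have -> : s + (y - inf F) * n%:R =
      \sum_(j < n) (lukasiewicz (A i j) (inf F) + (y - inf F)).
    by rewrite big_split /= sumr_const card_ord mulr_natr.
  by apply: ler_sum => j _; apply/lukasiewicz_lipschitz/minF.
have := minF y Fy; rewrite -natr1 mulrDr mulr1; lra.
Qed.

Lemma u_single_optimal i :
  single_feasible A b i !=set0 ->
  optimal_solution (single_feasible A b i) id (u_single A b i).
Proof.
move=> /single_feasible_inf/unique_optimal_solution_id Finf.
(* The infimum is a unique optimum, so the default branch of [xget] is impossible. *)
rewrite /u_single; case: xgetP => [y _ []//|/(_ _ Finf)//].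
Qed.

Lemma max_component_feasible x :
  solution_set A b x -> constant_feasible A b (max_component x).
Proof.
move=> [x01 bx]; split.
  by rewrite vmax_ge0 vmax_le // => j; case/andP: (x01 j).
move=> i; apply: le_trans (bx i) _; apply: ler_sum => j _.
exact/le_lukasiewicz/(le_vmax (fun j => x 0 j)).
Qed.

Lemma u_star_optimal :
  constant_feasible A b !=set0 ->
  optimal_solution (constant_feasible A b) id (u_star A b).
Proof.
move=> F0.
have singleF y i : constant_feasible A b y -> single_feasible A b i y.
  by case=> y01 by_; split.
have uP i : optimal_solution (single_feasible A b i) id (u_single A b i).
  by apply: u_single_optimal; case: F0 => y /singleF; exists y.
have ustar_le y : constant_feasible A b y -> u_star A b <= y.
  (* Besides the bounds on [u_single], the seed 0 of the maximum requires [0 <= y]. *)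
  move=> Fy; apply: vmax_le => [|i]; first by case: Fy => /andP[].
  by case: (uP i) => _; apply; apply: singleF.
split=> //.
have ustar1 : u_star A b <= 1.
  by case: F0 => y Fy; apply: le_trans (ustar_le y Fy) _; case: Fy => /andP[].
split=> [|i]; first by rewrite vmax_ge0.
by have [] := single_feasible_le (le_vmax _ i) ustar1 (uP i).1.
Qed.

End FuzzyRelationInequalities.

Theorem theorem5p7 (R : realType) (m n : nat)
    (A : 'M[R]_(m, n)) (b : 'rV[R]_m)
    (hA : forall i j, 0 <= A i j <= 1)
    (hb : forall i, 0 < b 0 i)
    (hS : solution_set A b !=set0) :
  unique_optimal_solution (constant_feasible A b) id (u_star A b) /\
  greatest_optimal_solution (solution_set A b) (@max_component R n)
    (const_mx (u_star A b)).
Proof.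
have uopt : optimal_solution (constant_feasible A b) id (u_star A b).
  apply: u_star_optimal; case: hS => x /max_component_feasible.
  by exists (max_component x).
split; first exact: unique_optimal_solution_id.
case: uopt => -[u01 bu] ustar_le.
have uS : solution_set A b (const_mx (u_star A b)).
  split=> [j|i]; first by rewrite mxE.
  by under eq_bigr do rewrite mxE; apply: bu.
have maxu : max_component (const_mx (u_star A b) : 'rV[R]_n) <= u_star A b.
  by apply: vmax_le => [|j]; [exact: vmax_ge0 | rewrite mxE].
split.
  split=> // x /max_component_feasible/ustar_le; exact: le_trans.
(* Testing the optimality of [x] against the feasible constant vector bounds its largest component
   by [u_star A b]. *)
move=> x [_ /(_ _ uS) xu] j; rewrite mxE.
apply: le_trans (le_trans xu maxu).
exact: (le_vmax (fun j => x 0 j)).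
Qed.
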